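(* Let $m\ge2$, $\omega>0$ and $r>0$. Suppose the real-valued functions $v_1,v_2,\ldots,v_m\in L_1[0,\omega]$ satisfy the composition condition. Let $u_1,u_2,\ldots,u_m\in L_1[0,\omega]$ be any solution of $$v_i(t)=u_i(t)-\frac{r\,u_{i+1}(t)}{1-rE_{x_1}[u](t)},\quad i=1,\ldots,m-1,\qquad v_m(t)=u_m(t),$$ with $E_{x_1}[u](t):=\int_0^t u_1(\tau)\,d\tau<1/r$ on the interval $[0,\omega]$. Then the composition condition with respect to $u_1,\ldots,u_m$ and the moment conditions with respect to $u_1,\ldots,u_m$ are equivalent.
   Context: Functions $w_1,\ldots,w_m\in L_1[0,\omega]$ satisfy the composition condition if there exist a differentiable function $q$ on $[0,\omega]$ with $q(\omega)=q(0)$ and continuous functions $\bar w_1,\ldots,\bar w_m$ such that $w_i(t)=\bar w_i(q(t))\,\dot q(t)$ for $i=1,\ldots,m$. Functions $w_1,\ldots,w_m\in L_1[0,\omega]$ satisfy the moment conditions if $$\int_0^\omega w_i(\tau)\Big(\int_0^\tau w_1(s)\,ds\Big)^k d\tau=0\qquad\text{for all } i=2,3,\ldots,m \text{ and all integers } k\ge0.$$ Equalities between $L_1$ functions hold almost everywhere. *)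

(* Defs.v *)
From HB Require Import structures.
From mathcomp Require Export all_boot all_order all_algebra.
From mathcomp Require Export all_classical all_reals all_analysis.
Export numFieldNormedType.Exports.

Set Implicit Arguments.
Unset Strict Implicit.
Unset Printing Implicit Defensive.

Import Order.TTheory GRing.Theory Num.Theory.

Local Open Scope classical_set_scope.
Local Open Scope ring_scope.

(* Families w_1, ..., w_m are indexed by 'I_m, so w_i is [w] at the ordinal of
   value i.-1.  A class in L_1[0, omega] is represented by a function R -> R
   integrable on [0, omega]; its values elsewhere are irrelevant.  Every class has
   a Borel representative, so Borel measurability in [integrable] loses nothing. *)

Definition L1_on {R : realType} (omega : R) (f : R -> R) : Prop :=
  (@lebesgue_measure R).-integrable `[0, omega] (EFin \o f).

(* The derivative is one-sided at the endpoints 0 and omega. *)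
Definition has_derivative_on {R : realType} (omega : R) (q dq : R -> R) : Prop :=
  forall t : R, t \in `[0, omega] ->
    (q s - q t) / (s - t) @[s --> within `[0, omega] t^'] --> dq t.

(* Only the values of [wbar i] on q([0, omega]), a compact interval, matter, so
   continuity on R is no restriction. *)
Definition composition_condition {R : realType} (omega : R) (m : nat)
    (w : 'I_m -> R -> R) : Prop :=
  exists (q dq : R -> R) (wbar : 'I_m -> R -> R),
    [/\ has_derivative_on omega q dq,
        q omega = q 0,
        forall i, continuous (wbar i) &
        forall i, ae_eq (@lebesgue_measure R) `[0, omega]%classic
                    (w i) (fun t : R => wbar i (q t) * dq t)].

Definition Ex1 {R : realType} (m : nat) (m_ge2 : (2 <= m)%N)
    (w : 'I_m -> R -> R) (t : R) : R :=
  \int[@lebesgue_measure R]_(s in `[0, t]) w (Ordinal (ltnW m_ge2)) s.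

Definition moment_conditions {R : realType} (omega : R) (m : nat)
    (m_ge2 : (2 <= m)%N) (w : 'I_m -> R -> R) : Prop :=
  forall (i : 'I_m) (k : nat), (0 < i)%N ->
    \int[@lebesgue_measure R]_(t in `[0, omega])
      (w i t * Ex1 m_ge2 w t ^+ k) = 0.

(* Main.v *)
Require Import Defs.
From mathcomp Require Import measurable_realfun.
From mathcomp Require Import lra ring.
Import Order.TTheory GRing.Theory Num.Theory.

Set Implicit Arguments.
Unset Strict Implicit.
Unset Printing Implicit Defensive.

Local Open Scope classical_set_scope.
Local Open Scope ring_scope.

(* Both conditions hold for [u].  Suppose w = g(q) q' a.e. with w integrable, g
   continuous and q differentiable everywhere.  Although q' need not be integrable,
   G o q (with G' = g) is differentiable everywhere with derivative a.e. equal to the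
   integrable w, so the primitive of w is G o q up to a constant.  In particular, if
   [u] satisfies the composition condition, then Ex1 is a continuous function of q,
   the integrands u_i Ex1^k have the form g(q) q', and their integrals over the loop
   vanish.

   Conversely, unfolding the relation between u and v gives
   u_i = sum_(j >= i) rho^(j - i) v_j a.e., where rho = r / (1 - r Ex1), so Ex1 solves
   the integral equation U(t) = int_0^t sum_j rho(U)^j v_j, which is Lipschitz in U
   with integrable weights.  The Picard iterates are continuous functions of q by the
   first paragraph and converge uniformly, so Ex1 = X(q) with X continuous, and q is a
   composition function for [u]. *)

(** * Induction along an interval and derivatives in epsilon-delta form *)

(** Let [x] be the supremum of the points where [P] holds. Some [s] just below [x] satisfies [P], so
    [P] passes to a point beyond [x], unless [x] is [b]. A step that straddles [x] merges the limit
    and successor cases of real induction. *)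
Lemma interval_induction {R : realType} (b : R) (P : R -> Prop) :
  0 <= b -> P 0 ->
  (forall x, 0 <= x <= b -> exists2 d, 0 < d & forall s t,
     0 <= s <= x -> x <= t <= b -> x - s < d -> t - x < d -> P s -> P t) ->
  P b.
Proof.
move=> b0 P0 step; pose S := [set t | 0 <= t <= b /\ P t].
have S0 : S 0 by rewrite /S/= lexx b0.
have supS : has_sup S.
  by split; [exists 0 | exists b => t [/andP[]]].
have c0 : 0 <= sup S by apply: ub_le_sup => //; case: supS.
have cb : sup S <= b by apply: ge_sup; [exists 0 | move=> t [/andP[]]].
have [|d d0 dP] := step (sup S); first by rewrite c0 cb.
have [s Ss ds] := sup_adherent d0 supS.
have sc : s <= sup S by apply: ub_le_sup => //; case: supS.
case: Ss => /andP[s0 sb] Ps.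
pose t := Num.min b (sup S + d / 2).
have ct : sup S <= t by rewrite /t le_min cb lerDl; lra.
have tb : t <= b by rewrite /t ge_min lexx.
have tc : t <= sup S + d / 2 by rewrite /t ge_min lexx orbT.
have Pt : P t by apply: (dP s) => //; rewrite ?s0 ?ct ?tb//; lra.
have : t <= sup S.
  by apply: ub_le_sup; [case: supS | split => //; rewrite tb andbT (le_trans c0)].
rewrite {1}/t ge_min => /orP[bc|]; last by lra.
suff <- : t = b by [].
by apply/eqP; rewrite eq_le tb/= (le_trans bc).
Qed.

(** Clearing the denominator admits [s = t] and turns later differentiability arguments into plain
    estimates. *)
Lemma has_derivative_onP {R : realType} (b : R) (q dq : R -> R) :
  has_derivative_on b q dq <->
  forall t : R, 0 <= t <= b -> forall e : R, 0 < e ->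
  exists2 d : R, 0 < d & forall s : R, 0 <= s <= b -> `|s - t| < d ->
    `|q s - q t - dq t * (s - t)| <= e * `|s - t|.
Proof.
have slopeE t s e : s != t ->
    (`|dq t - (q s - q t) / (s - t)| <= e) =
    (`|q s - q t - dq t * (s - t)| <= e * `|s - t|).
  move=> st; have st0 : 0 < `|s - t| by rewrite normr_gt0 subr_eq0.
  rewrite -ler_pdivrMr// -normf_div -normrN; congr (`|_| <= _).
  by field; rewrite subr_eq0.
split=> [qd t tb e e0|qd t].
  have := qd t; rewrite in_itv/= => /(_ tb).
  move=> /cvgrPdist_le/(_ _ e0); rewrite near_withinE.
  rewrite /dnbhs near_withinE => /nbhs_ballP[d/= d0 dP].
  exists d => // s sb sd; have [->|st] := eqVneq s t.
    by rewrite !subrr mulr0 subr0 normr0 mulr0.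
  have := dP s; rewrite /ball/= distrC => /(_ sd st); rewrite in_itv/= => /(_ sb).
  by rewrite slopeE.
rewrite in_itv/= => tb; apply/cvgrPdist_le => e e0; rewrite near_withinE.
rewrite /dnbhs near_withinE; apply/nbhs_ballP.
have [d d0 dP] := qd t tb e e0; exists d => //= s sd st.
rewrite in_itv/= => sb; rewrite slopeE//; apply: dP => //.
by rewrite distrC.
Qed.

(** * Majorants in the style of Vitali-Caratheodory *)

Section vitali_caratheodory.
Context {R : realType}.
Notation mu := (@lebesgue_measure R).
Local Open Scope ereal_scope.

Let le_mu (A B : set R) : measurable A -> measurable B -> A `<=` B -> mu A <= mu B.
Proof. by move=> mA mB AB; apply: le_measure; rewrite ?inE. Qed.

(* [g] is a sum of multiples of indicators of open sets, each covering a level set of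
   [f] together with the null set where [h] is not [f]. *)
Lemma vitali_caratheodory (D : set R) (f h : R -> R) (eps : R) :
  measurable D -> mu D < +oo -> (0 < eps)%R ->
  mu.-integrable D (EFin \o f) ->
  (forall x, D x -> 0 <= f x)%R -> (forall x, D x -> 0 <= h x)%R ->
  ae_eq mu D f h ->
  exists g : R -> \bar R, [/\ measurable_fun setT g, (forall x, 0 <= g x),
    \int[mu]_(x in D) g x <= \int[mu]_(x in D) (f x)%:E + eps%:E &
    forall x, D x -> \forall t \near x, (h x)%:E <= g t].
Proof.
move=> mD Doo eps0 intf f0 h0 fh.
have [N [mN N0 fhN]] : exists N : set R,
    [/\ measurable N, mu N = 0 & forall x, D x -> ~ N x -> f x = h x].
  have [N [mN N0 fhN]] := fh; exists N; split => // x Dx Nx.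
  by apply: contrapT => neq; apply: Nx; apply: fhN => /= /(_ Dx).
have mf : measurable_fun D f by apply/measurable_EFinP; case/integrableP: intf.
(* Rounding [f] up to a multiple of [e] costs at most [e * mu D <= eps / 2]; the [+ 1] keeps the
   denominator positive. The other half of [eps] pays for the open sets. *)
pose e : R := (eps / (2 * (fine (mu D) + 1)))%R.
have Dfin : mu D \is a fin_num by rewrite ge0_fin_numE.
have muD0 : (0 <= fine (mu D))%R by rewrite fine_ge0.
have e0 : (0 < e)%R by rewrite /e divr_gt0// mulr_gt0// ltr_wpDl.
pose c (k : nat) : R := (k.+1%:R * e)%R.
have c0 k : (0 < c k)%R by rewrite /c mulr_gt0.
pose E (k : nat) := D `&` f @^-1` `[(k%:R * e)%R, c k[.
have mE k : measurable (E k) by apply: mf.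
have mEN k : measurable (E k `|` N) by exact: measurableU.
have muEN k : mu (E k `|` N) = mu (E k).
  by apply: measureU0 => //; exact: mE.
have ND k : mu (E k `|` N) < +oo.
  rewrite muEN; apply: le_lt_trans Doo.
  by apply: le_mu => //; apply: subIsetl.
(* Dividing by [c k] cancels the weight of [U k] in [g], so the excesses of the open sets sum to
   [eps / 2]. *)
have d0 k : (0 < eps / 2 / (2 ^ k.+1)%:R / c k)%R.
  by rewrite !divr_gt0// ltr0n expn_gt0.
have covU k : exists U : set R, [/\ open U, E k `|` N `<=` U &
    mu (U `\` (E k `|` N)) < (eps / 2 / (2 ^ k.+1)%:R / c k)%:E].
  exact: (lebesgue_regularity_outer (mEN k) (ND k) (d0 k)).
have [U OP] := choice covU.
have mO k : measurable (U k) by apply: open_measurable; case: (OP k).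
pose g (x : R) := \sum_(k <oo) ((c k)%:E * (\1_(U k) x)%:E).
have t0 k x : 0 <= (c k)%:E * (\1_(U k) x)%:E.
  by rewrite mule_ge0// lee_fin// ltW.
have mUE k : measurable (U k `\` (E k `|` N)).
  by apply: measurableD; [exact: mO | exact: mEN].
have mi k A : measurable_fun A (fun x => (\1_(U k) x)%:E).
  by apply/measurable_EFinP; apply: measurable_funTS; exact: measurable_indic.
have mt k A : measurable_fun A (fun x => (c k)%:E * (\1_(U k) x)%:E).
  by apply: emeasurable_funM => //; exact: mi.
exists g; split.
- by apply: ge0_emeasurable_sum => // k x _ _.
- by move=> x; apply: nneseries_ge0 => k _ _.
- rewrite integral_nneseries//; last by move=> k; exact: mt.
  pose fe x := (f x + e)%:E.
  have mfe : measurable_fun D fe.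
    by apply/measurable_EFinP; apply: measurable_funD.
  have fe0 x : D x -> 0 <= fe x.
    by move=> Dx; rewrite lee_fin addr_ge0 ?f0// ltW.
  apply: (@le_trans _ _ (\sum_(k <oo) (\int[mu]_(x in E k) fe x + (eps / 2 / (2 ^ k.+1)%:R)%:E))).
    apply: lee_nneseries => [k _ _|k _]; first by apply: integral_ge0.
    rewrite ge0_integralZl//; last 2 first.
    + exact: mi.
    + by rewrite lee_fin ltW.
    rewrite integral_indic//; last exact: mO.
    apply: (@le_trans _ _ ((c k)%:E * (mu (E k) + (eps / 2 / (2 ^ k.+1)%:R / c k)%:E))).
      rewrite lee_pmul2l ?lte_fin//.
      apply: (@le_trans _ _ (mu ((E k `|` N) `|` (U k `\` (E k `|` N))))).
        apply: le_mu => //.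
        - exact: measurableI.
        - by apply: measurableU; [exact: mEN | exact: mUE].
        - by move=> x [Ox Dx]; have [?|?] := pselect ((E k `|` N) x); [left|right].
      apply: (le_trans (measureU2 _ _ _)).
      - exact: mEN.
      - exact: mUE.
      by apply: leeD; [by rewrite -(muEN k) | apply: ltW; case: (OP k)].
    rewrite muleDr// ?ge0_adde_def ?inE//; last by rewrite lee_fin ltW.
    apply: leeD; last by rewrite -EFinM lee_fin mulrC divfK// gt_eqF.
    have -> : (c k)%:E * mu (E k) = \int[mu]_(x in E k) (c k)%:E.
      by rewrite integral_cst//; exact: mE.
    apply: ge0_le_integral => //.
    + exact: mE.
    + by move=> x _; rewrite lee_fin ltW.
    + by apply: measurable_funS mfe => //; exact: subIsetl.
    + move=> x [Dx]; rewrite /= in_itv/= => /andP[kf _].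
      by rewrite lee_fin /c -natr1 mulrDl mul1r lerD2r.
  have e20 : (0 <= eps / 2)%R by rewrite divr_ge0// ltW.
  have fE0 k : 0 <= \int[mu]_(x in E k) fe x.
    by apply: integral_ge0 => x [Dx _]; exact: fe0.
  apply: (le_trans (epsilon_trick _ fE0 e20)).
  have ED : \bigcup_k E k `<=` D by move=> x [k _ []].
  have mEE : measurable (\bigcup_k E k) by exact: bigcup_measurable.
  have tE : trivIset setT E.
    apply/trivIsetP => i j _ _; wlog ij : i j / (i < j)%N.
      move=> H; rewrite neq_ltn => /orP[ij|ji]; first by apply: H => //; rewrite ltn_eqF.
      by rewrite setIC; apply: H => //; rewrite ltn_eqF.
    move=> _; rewrite -subset0 => x [[_ +] [_ +]]; rewrite /= !in_itv/=.
    move=> /andP[_ +] /andP[+ _]; rewrite ltNge => /negP h1 h2; apply: h1.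
    by apply: le_trans h2; rewrite /c ler_pM2r// ler_nat.
  have -> : \sum_(k <oo) \int[mu]_(x in E k) fe x = \int[mu]_(x in \bigcup_k E k) fe x.
    rewrite ge0_integral_bigcup//; first by exact: measurable_funS mfe.
    by move=> x /ED; exact: fe0.
  apply: (@le_trans _ _ (\int[mu]_(x in D) fe x + (eps / 2)%:E)).
    by rewrite leeD2r//; exact: ge0_subset_integral.
  rewrite {1}/fe; under eq_integral do rewrite EFinD.
  rewrite ge0_integralD//; last 2 first.
  - by case/integrableP: intf.
  - by move=> x _; rewrite lee_fin ltW.
  rewrite -addeA leeD2l//.
  have -> : \int[mu]_(_ in D) e%:E = (e * fine (mu D))%:E.
    transitivity (e%:E * mu D); first exact: integral_cst.
    by rewrite -[in LHS](fineK Dfin) -EFinM.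
  rewrite -EFinD lee_fin [leRHS]splitr lerD2r /e invfM -!mulrA ler_pM2l// ler_piMr//.
  by rewrite ler_pdivrMl ?mulr1 ?lerDl// ltr_wpDl.
(* [k] is the level of [h x]. Since [U k] contains all of [N], it contains [x] even where [h]
   differs from [f], and its term [c k > h x] alone bounds [g] from below near [x]. *)
- move=> x Dx; pose k := Num.truncn (h x / e).
  have /andP[k1 k2] : (k%:R * e <= h x < c k)%R.
    rewrite -ler_pdivlMr// /c -ltr_pdivrMr//.
    by apply: Num.Theory.truncn_itv; rewrite divr_ge0 ?h0// ltW.
  have [oO sO _] := OP k.
  have Ox : U k x.
    apply: sO; have [Nx|Nx] := pselect (N x); [by right|left; split => //].
    rewrite /= in_itv/=; by rewrite (fhN _ Dx Nx) k1.
  have := open_nbhs_nbhs (conj oO Ox); apply: filterS => t Ot.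
  apply: (@le_trans _ _ ((c k)%:E * (\1_(U k) t)%:E)).
    by rewrite indicE mem_set// mule1 lee_fin ltW.
  rewrite /g (@nneseriesD1 _ _ k)//.
  by rewrite leeDl// nneseries_ge0.
Qed.

End vitali_caratheodory.

(** * Derivatives and integrable functions on [[0, b]] *)

Section lebesgue.
Context {R : realType}.
Notation mu := (@lebesgue_measure R).
Implicit Types (b t : R) (q dq F dF G g f h w : R -> R).

Lemma has_derivative_onS b t F dF :
  t <= b -> has_derivative_on b F dF -> has_derivative_on t F dF.
Proof.
move=> tb /has_derivative_onP dFP; apply/has_derivative_onP => x /andP[x0 xt] e e0.
have [|d d0 dP] := dFP x _ e e0; first by rewrite x0 (le_trans xt).
by exists d => // s /andP[s0 st]; apply: dP; rewrite s0 (le_trans st).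
Qed.

Lemma has_derivative_onN b F dF :
  has_derivative_on b F dF -> has_derivative_on b (-%R \o F) (-%R \o dF).
Proof.
move=> /has_derivative_onP dFP; apply/has_derivative_onP => x xb e e0.
have [d d0 dP] := dFP x xb e e0; exists d => // s sb sd /=.
rewrite -normrN [X in `|X|](_ : _ = F s - F x - dF x * (s - x)); last by ring.
exact: dP.
Qed.

Lemma has_derivative_onD_linear b F dF (c : R) :
  has_derivative_on b F dF ->
  has_derivative_on b (fun t => F t + c * t) (fun t => dF t + c).
Proof.
move=> /has_derivative_onP dFP; apply/has_derivative_onP => x xb e e0.
have [d d0 dP] := dFP x xb e e0; exists d => // s sb sd /=.
rewrite [X in `|X|](_ : _ = F s - F x - dF x * (s - x)); last by ring.
exact: dP.
Qed.

Lemma L1_onS b t f : t <= b -> L1_on b f -> L1_on t f.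
Proof.
move=> tb; apply: integrableS => //.
by apply: subset_itvl; rewrite bnd_simp.
Qed.

Lemma L1_onD b f h : L1_on b f -> L1_on b h -> L1_on b (fun t => f t + h t).
Proof. 
move=> fi hi; have := @integrableD _ _ R mu `[0, b]%classic (measurable_itv _) _ _ fi hi.
by apply: eq_integrable. Qed.

Lemma L1_onN b f : L1_on b f -> L1_on b (-%R \o f).
Proof.
move=> fi; have := @integrableN _ _ R mu `[0, b]%classic _ fi.
by apply: eq_integrable.
Qed.

Lemma L1_on_EFin_int b f : L1_on b f ->
  (\int[mu]_(x in `[0%R, b]) (f x)%:E = (\int[mu]_(x in `[0%R, b]) f x)%:E)%E.
Proof.
by move=> fi; rewrite /Rintegral fineK//; exact: integrable_fin_num.
Qed.

Lemma lebesgue_measure_itvcc_lty b : (mu `[0%R, b] < +oo)%E.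
Proof. by rewrite lebesgue_measure_itv/=; case: ifP => // _; rewrite -EFinB ltry. Qed.

Lemma L1_on_cst b (c : R) : L1_on b (fun=> c).
Proof.
apply: measurable_bounded_integrable => //; first exact: lebesgue_measure_itvcc_lty.
exact: bounded_cst.
Qed.

Lemma Rintegral_cst_itv0cc b (c : R) : 0 <= b -> \int[mu]_(x in `[0, b]) c = c * b.
Proof.
move=> b0; rewrite Rintegral_cst//=; congr (_ * _).
rewrite lebesgue_measure_itv/= lte_fin; have [_|b0'] := ltP 0 b.
  by rewrite /= subr0.
by apply/eqP; rewrite eq_le b0.
Qed.

(** * Integration of derivatives that exist everywhere *)

(** [h] dominates the derivative at every point, while [f] matches it only almost everywhere. The
    majorant [g] from [vitali_caratheodory] stays above [h x] near each [x] and has an integral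
    barely larger than that of [f], so [interval_induction] propagates the bound on the increment of
    [F]. *)
Lemma ge0_has_derivative_on_le b F dF f h : 0 <= b ->
  has_derivative_on b F dF ->
  (forall t, 0 <= t <= b -> dF t <= h t) ->
  (forall t, 0 <= t <= b -> 0 <= h t) ->
  (forall t, 0 <= t <= b -> 0 <= f t) ->
  L1_on b f -> ae_eq mu `[0, b]%classic f h ->
  F b - F 0 <= \int[mu]_(x in `[0, b]) f x.
Proof.
move=> b0 /has_derivative_onP dFP dFh h0 f0 fi fh.
apply/ler_addgt0Pr => e e0.
have e20 : 0 < e / 2 by rewrite divr_gt0.
have [||g [mg g0 gf gh]] := @vitali_caratheodory R `[0, b]%classic f h (e / 2)
  (measurable_itv _) (lebesgue_measure_itvcc_lty b) e20 fi _ _ fh.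
- by move=> x; rewrite /= in_itv/=; exact: f0.
- by move=> x; rewrite /= in_itv/=; exact: h0.
have mgS (A : set R) : measurable_fun A g by exact: measurable_funTS.
(* The tolerance in the derivative of [F]: over [[0, b]] it costs [n * b <= e / 2], and [g] costs
   the other half of [e]. *)
pose n := e / 2 / (b + 1).
have b1 : 0 < b + 1 by rewrite ltr_wpDl.
have n0 : 0 < n by rewrite divr_gt0.
suff : ((F b - F 0)%:E <= \int[mu]_(x in `[0%R, b]) g x + (n * b)%:E)%E.
  move=> /le_trans/(_ (leeD2r _ gf)); rewrite L1_on_EFin_int// -!EFinD lee_fin.
  move=> /le_trans; apply; rewrite -addrA lerD2l [leRHS]splitr lerD2l.
  by rewrite /n mulrAC ler_pdivrMr// ler_pM2l// lerDl.
apply: (@interval_induction _ b (fun t =>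
  (F t - F 0)%:E <= \int[mu]_(x in `[0%R, t]) g x + (n * t)%:E)%E) => //.
  by rewrite subrr mulr0 adde0 integral_ge0.
move=> x xb; have [d1 d10 d1P] := dFP x xb n n0.
have /nbhs_ballP[d2/= d20 d2P] : \forall t \near x, ((h x)%:E <= g t)%E.
  by apply: gh; rewrite /= in_itv.
exists (Num.min d1 d2) => [|s t]; first by rewrite lt_min d10.
move=> /andP[s0 sx] /andP[xt tb]; rewrite !lt_min => /andP[xs1 xs2] /andP[tx1 tx2] Ps.
have st : s <= t by exact: le_trans xt.
have -> : (\int[mu]_(x in `[0%R, t]) g x =
    \int[mu]_(x in `[0%R, s]) g x + \int[mu]_(x in `]s, t]) g x)%E.
  rewrite -ge0_integral_setU//=.
  - by rewrite -itv_bndbnd_setU//= bnd_simp.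
  - exact: mgS.
  - apply/disj_setPS => y [/=]; rewrite !in_itv/= => /andP[_ ys] /andP[].
    by rewrite ltNge ys.
have hx : ((h x * (t - s))%:E <= \int[mu]_(x in `]s, t]) g x)%E.
  have -> : ((h x * (t - s))%:E = \int[mu]_(x0 in `]s, t]) (h x)%:E)%E.
    rewrite integral_cst//= lebesgue_measure_itv/= lte_fin.
    have [_|ts] := ltP s t; first by rewrite -EFinB EFinM.
    have -> : t = s by apply/eqP; rewrite eq_le ts.
    by rewrite subrr mulr0 mule0.
  apply: ge0_le_integral => //.
  - by move=> y _; rewrite lee_fin h0.
  - exact: mgS.
  - move=> y; rewrite /= in_itv/= => /andP[sy yt]; apply: d2P.
    by rewrite /ball/= ltr_norml; apply/andP; split; lra.
(* Differentiability at [x], used towards [s] and towards [t], bounds the increment across [x]; the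
   two errors add up to [n * (t - s)]. *)
have Fst : F t - F s <= (h x + n) * (t - s).
  have h1 : `|F t - F x - dF x * (t - x)| <= n * (t - x).
    rewrite -[in leRHS](ger0_norm (_ : 0 <= t - x)) ?subr_ge0//.
    by apply: d1P; [rewrite tb (le_trans s0) | rewrite ger0_norm ?subr_ge0].
  have h2 : `|F s - F x - dF x * (s - x)| <= n * (x - s).
    rewrite -[in leRHS](ger0_norm (_ : 0 <= x - s)) ?subr_ge0// [in leRHS]distrC.
    by apply: d1P; [rewrite s0 (le_trans st) | rewrite distrC ger0_norm ?subr_ge0].
  have h3 : (dF x + n) * (t - s) <= (h x + n) * (t - s).
    by rewrite ler_wpM2r ?subr_ge0// lerD2r dFh.
  apply: le_trans h3; move: h1 h2; rewrite !ler_norml => /andP[_ h1] /andP[h2 _].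
  by lra.
have -> : F t - F 0 = (F s - F 0) + (F t - F s) by ring.
have -> : n * t = n * s + n * (t - s) by ring.
rewrite (EFinD (F s - F 0)) (EFinD (n * s)) addeACA; apply: leeD => //.
apply: (@le_trans _ _ ((h x + n) * (t - s))%:E); first by rewrite lee_fin.
by rewrite mulrDl EFinD leeD2r.
Qed.

(* Truncating [f] from below by [- n] and adding [n] to it reduces to the nonnegative
   case; then [n] tends to infinity. *)
Lemma has_derivative_on_le b F dF f : 0 <= b ->
  has_derivative_on b F dF -> L1_on b f -> ae_eq mu `[0, b]%classic f dF ->
  F b - F 0 <= \int[mu]_(x in `[0, b]) f x.
Proof.
move=> b0 dFP fi fdF.
have mf : measurable_fun `[0, b]%classic f.
  by apply/measurable_EFinP; case/integrableP: fi.
pose fn (n : nat) x := Num.max (f x) (- n%:R).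
have mfn n : measurable_fun `[0, b]%classic (fn n) by exact: measurable_maxr.
have fnf n x : `|fn n x| <= `|f x|.
  rewrite /fn; have [//|fx] := leP (- n%:R) (f x).
  have n0 : 0 <= n%:R :> R by [].
  by rewrite normrN ger0_norm// ltr0_norm; lra.
have ifn n : L1_on b (fn n).
  apply: le_integrable (integrable_norm fi) => //.
    apply/measurable_EFinP.
    exact: mfn.
  by move=> x _; rewrite /= lee_fin normr_id.
have key n : F b - F 0 <= \int[mu]_(x in `[0, b]) fn n x.
  have cst_int : L1_on b (fun=> n%:R) := L1_on_cst b n%:R.
  have := @ge0_has_derivative_on_le b (fun t => F t + n%:R * t) (fun t => dF t + n%:R)
    (fun t => fn n t + n%:R) (fun t => Num.max (dF t) (- n%:R) + n%:R) b0
    (@has_derivative_onD_linear b F dF n%:R dFP).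
  have -> : \int[mu]_(x in `[0, b]) (fn n x + n%:R) =
      \int[mu]_(x in `[0, b]) fn n x + n%:R * b.
    rewrite -(Rintegral_cst_itv0cc n%:R b0).
    by apply: RintegralD => //; exact: ifn.
  have : (F b + n%:R * b - (F 0 + n%:R * 0)) = F b - F 0 + n%:R * b by ring.
  move=> ->; rewrite lerD2r; apply.
  - by move=> t _; rewrite lerD2r le_max lexx.
  - by move=> t _; rewrite -lerBlDr sub0r le_max lexx orbT.
  - by move=> t _; rewrite -lerBlDr sub0r le_max lexx orbT.
  - exact: L1_onD.
  - by apply: filterS fdF => x fx Dx; rewrite /fn fx.
have fn_cvg : {ae mu, forall x, `[0, b]%classic x ->
    (fun n => (EFin \o fn n) x) @ \oo --> (EFin \o f) x}.
  apply: aeW => x _; apply: cvg_near_cst; near=> n.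
  have fxn : `|f x| <= n%:R by near: n; exact: nbhs_infty_ger.
  congr EFin; apply: max_l; rewrite lerNl (le_trans _ fxn)//.
  by rewrite -normrN ler_norm.
have fn_le : {ae mu, forall x n, `[0, b]%classic x ->
    (`|(EFin \o fn n) x| <= `|f x|%:E)%E}.
  by apply: aeW => x n _; rewrite /= lee_fin.
have [_ _ ifn_cvg] := @dominated_convergence _ _ R mu `[0, b]%classic (measurable_itv _)
  (fun n => EFin \o fn n) (EFin \o f) (fun x => `|f x|%:E)
  (fun n => (measurable_EFinP _ _).2 (mfn n)) ((measurable_EFinP _ _).2 mf) fn_cvg
  (integrable_norm fi) fn_le.
rewrite -lee_fin -L1_on_EFin_int//.
apply: (cvge_ge _ ifn_cvg); near=> n.
by have := key n; rewrite -lee_fin -(L1_on_EFin_int (ifn n)).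
Unshelve. all: by end_near. Qed.

(* The derivative is only assumed to be a.e. equal to an integrable function: neither
   its continuity nor its boundedness is available. *)
Theorem has_derivative_on_int b F dF f t : 0 <= t <= b ->
  has_derivative_on b F dF -> L1_on b f -> ae_eq mu `[0, b]%classic f dF ->
  \int[mu]_(x in `[0, t]) f x = F t - F 0.
Proof.
move=> /andP[t0 tb] /(has_derivative_onS tb) dFt /(L1_onS tb) fi fdF.
have {}fdF : ae_eq mu `[0, t]%classic f dF.
  by apply: ae_eq_subset fdF; apply: subset_itvl; rewrite bnd_simp.
apply/eqP; rewrite eq_le (has_derivative_on_le t0 dFt fi fdF) andbT.
(* The reverse inequality is the same bound for [- F]. *)
have fiN : L1_on t (-%R \o f) by exact: L1_onN.
have := has_derivative_on_le t0 (has_derivative_onN dFt) fiN (ae_eq_comp (-%R) fdF).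
rewrite /= (_ : \int[mu]_(x in `[0, t]) (-%R \o f) x = - \int[mu]_(x in `[0, t]) f x).
  by lra.
by rewrite -mulN1r -RintegralZl//; apply: eq_Rintegral => x _; rewrite mulN1r.
Qed.

(** * Continuity and the chain rule on [[0, b]] *)

Lemma within_itv0ccP b (f : R -> R) :
  {within `[0, b], continuous f} <->
  forall t : R, 0 <= t <= b -> forall e : R, 0 < e -> exists2 d : R, 0 < d &
    forall s : R, 0 <= s <= b -> `|s - t| < d -> `|f s - f t| <= e.
Proof.
split=> [/subspace_continuousP fc t tb e e0|fc].
  have := fc t; rewrite /= in_itv/= => /(_ tb)/cvgrPdist_le/(_ _ e0).
  rewrite near_withinE => /nbhs_ballP[d/= d0 dP].
  exists d => // s sb sd; rewrite distrC; apply: dP; last by rewrite /= in_itv.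
  by rewrite /ball/= distrC.
apply/subspace_continuousP => t; rewrite /= in_itv/= => tb.
apply/cvgrPdist_le => e e0; rewrite near_withinE; apply/nbhs_ballP.
have [d d0 dP] := fc t tb e e0; exists d => //= s sd; rewrite in_itv/= => sb.
by rewrite distrC; apply: dP; rewrite // distrC.
Qed.

Lemma has_derivative_on_continuous b q dq :
  has_derivative_on b q dq -> {within `[0, b], continuous q}.
Proof.
move=> /has_derivative_onP qd; apply/within_itv0ccP => t tb e e0.
have [d d0 dP] := qd t tb 1 ltr01.
have k0 : 0 < `|dq t| + 1 by rewrite ltr_wpDl.
exists (Num.min d (e / (`|dq t| + 1))); first by rewrite lt_min d0 divr_gt0.
move=> s sb; rewrite lt_min => /andP[sd se].
have -> : q s - q t = (q s - q t - dq t * (s - t)) + dq t * (s - t) by ring.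
rewrite (le_trans (ler_normD _ _))// (le_trans (lerD (dP s sb sd) (lexx _)))//.
by rewrite normrM -mulrDl addrC -ler_pdivlMl// mulrC ltW.
Qed.

Lemma has_derivative_on_comp b q dq G g :
  has_derivative_on b q dq ->
  (forall t, 0 <= t <= b ->
    h^-1 *: (G (h + q t) - G (q t)) @[h --> 0^'] --> g (q t)) ->
  has_derivative_on b (G \o q) (fun t => g (q t) * dq t).
Proof.
move=> qd Gd; have /within_itv0ccP qc := has_derivative_on_continuous qd.
move/has_derivative_onP : qd => qd.
apply/has_derivative_onP => t tb e e0.
have k0 : 0 < `|dq t| + 1 by rewrite ltr_wpDl.
have l0 : 0 < `|g (q t)| + 1 by rewrite ltr_wpDl.
have ek0 : 0 < e / 2 / (`|dq t| + 1) by rewrite !divr_gt0.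
have el0 : 0 < e / 2 / (`|g (q t)| + 1) by rewrite !divr_gt0.
have := Gd t tb => /cvgrPdist_le/(_ _ ek0).
rewrite /dnbhs near_withinE => /nbhs_ballP[d1/= d10 d1P].
have [d2 d20 d2P] := qc t tb (d1 / 2) (divr_gt0 d10 (ltr0Sn _ _)).
have [d3 d30 d3P] := qd t tb _ el0.
have [d4 d40 d4P] := qd t tb 1 ltr01.
have GP z : `|z - q t| < d1 ->
    `|G z - G (q t) - g (q t) * (z - q t)| <= e / 2 / (`|dq t| + 1) * `|z - q t|.
  move=> zd; have [->|zq] := eqVneq z (q t).
    by rewrite !subrr mulr0 subr0 normr0 mulr0.
  have zq0 : z - q t != 0 by rewrite subr_eq0.
  have := d1P (z - q t); rewrite /ball/= sub0r normrN subrK => /(_ zd zq0) H.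
  rewrite -ler_pdivrMr ?normr_gt0// -normf_div -normrN.
  apply: le_trans H; rewrite le_eqVlt; apply/orP; left; apply/eqP; congr (`|_|).
  by rewrite /GRing.scale/=; field.
exists (Num.min d2 (Num.min d3 d4)); first by rewrite !lt_min d20 d30 d40.
move=> s sb; rewrite !lt_min => /andP[sd2 /andP[sd3 sd4]] /=.
have qst : `|q s - q t| <= (`|dq t| + 1) * `|s - t|.
  have -> : q s - q t = (q s - q t - dq t * (s - t)) + dq t * (s - t) by ring.
  rewrite (le_trans (ler_normD _ _))// (le_trans (lerD (d4P s sb sd4) (lexx _)))//.
  by rewrite normrM -mulrDl addrC.
(* The error splits into that of [G] at [q t], controlled through the bound [|dq t| + 1] on the
   quotients of [q], and that of [q] at [t], multiplied by [g (q t)]. Each takes half of [e]. *)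
have -> : G (q s) - G (q t) - g (q t) * dq t * (s - t) =
  (G (q s) - G (q t) - g (q t) * (q s - q t)) +
  g (q t) * (q s - q t - dq t * (s - t)) by ring.
rewrite (le_trans (ler_normD _ _))// (splitr e) mulrDl; apply: lerD.
  apply: (le_trans (GP _ _)).
    by rewrite (le_lt_trans (d2P s sb sd2))// ltr_pdivrMr// ltr_pMr// ltr1n.
  apply: (le_trans (ler_wpM2l (ltW ek0) qst)).
  by rewrite mulrA divfK// gt_eqF.
rewrite normrM; apply: (le_trans (ler_wpM2l (normr_ge0 _) (d3P s sb sd3))).
rewrite mulrA ler_wpM2r// mulrCA ler_piMr ?divr_ge0 ?(ltW e0)//.
by rewrite ler_pdivrMr// mul1r lerDl.
Qed.

(** * Primitives and uniform limits that factor through [q] *)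

Lemma has_derivative_on_min b q dq : 0 <= b -> has_derivative_on b q dq ->
  exists a, forall t, 0 <= t <= b -> a <= q t.
Proof.
move=> b0 /has_derivative_on_continuous qc.
have [t _ tP] := EVT_min b0 qc; exists (q t) => s sb; apply: tP.
by rewrite in_itv.
Qed.

(** With [G] a primitive of [g], the chain rule makes [G \o q] differentiable everywhere with
    derivative [g (q t) * dq t], and [has_derivative_on_int] then integrates [w]. *)
Lemma primitive_comp b q dq g w : 0 <= b -> has_derivative_on b q dq ->
  continuous g -> L1_on b w -> ae_eq mu `[0, b]%classic w (fun t => g (q t) * dq t) ->
  exists2 Y : R -> R, continuous Y &
    forall t, 0 <= t <= b -> \int[mu]_(s in `[0, t]) w s = Y (q t).
Proof.
move=> b0 qd gc wi wE; have [a aq] := has_derivative_on_min b0 qd.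
(* Starting at [a - 1] puts every value of [q], its minimum included, in the interior, where [G] has
   a two-sided derivative. *)
pose G (y : R) := \int[mu]_(s in `[a - 1, y]) g s.
have dG y : a <= y -> derivable G y 1 /\ derive1 G y = g y.
  move=> ay; apply: (@continuous_FTC1_closed _ g (a - 1) y (y + 1)) => //.
  - by rewrite ltrDl.
  - apply: continuous_compact_integrable; first exact: segment_compact.
    exact: continuous_subspaceT.
  - by lra.
  - exact: gc.
(* [G] is controlled only above [a]; the [max] makes the function continuous on all of [R] and is
   inactive on the values of [q]. *)
exists (fun y => G (Num.max a y) - G (q 0)).
  move=> y; apply: cvgB; last exact: cvg_cst.
  apply: (@continuous_comp _ _ _ (fun y => Num.max a y) G).
    by apply: continuous_max; [exact: cvg_cst | exact: cvg_id].
  have [|dGy _] := dG (Num.max a y); first by rewrite le_max lexx.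
  by apply: differentiable_continuous; apply/derivable1_diffP.
move=> t tb; rewrite (max_r (aq t tb)).
apply: (@has_derivative_on_int b (G \o q) _ w t tb _ wi wE).
apply: has_derivative_on_comp => // s sb.
have [dGs <-] := dG (q s) (aq s sb).
rewrite derive1E; have := dGs; rewrite /derivable /derive.
by under eq_fun do rewrite scaler1.
Qed.

(** As a uniform limit of functions of [q], [U] is constant on the fibres of [q]. Hence [U] is
    [U \o tau] composed with [q], for any choice [tau] of preimages. Although [tau] may jump,
    [U \o tau] is a uniform limit of continuous functions. *)
Lemma factor_uniform_limit b q (U : R -> R) : 0 <= b ->
  {within `[0, b], continuous q} ->
  (forall e : R, 0 < e -> exists2 Y : R -> R, continuous Y &
     forall t, 0 <= t <= b -> `|Y (q t) - U t| <= e) ->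
  exists2 X : R -> R, continuous X & forall t, 0 <= t <= b -> U t = X (q t).
Proof.
move=> b0 qc Yq.
have [tm tmb qm] := EVT_min b0 qc; have [tM tMb qM] := EVT_max b0 qc.
rewrite !in_itv/= in tmb tMb.
(* [clamp] retracts [R] onto the range of [q], so that every real gets a preimage under [tau]. *)
pose clamp y := Num.min (Num.max y (q tm)) (q tM).
have mM : q tm <= q tM by apply: qm; rewrite in_itv.
have clampq t : 0 <= t <= b -> clamp (q t) = q t.
  by move=> tb; rewrite /clamp max_l ?min_l ?qM ?qm// in_itv.
have clamp_continuous : continuous clamp.
  move=> y; apply: (@continuous_min _ _ (fun y => Num.max y (q tm)) (fun=> q tM)).
    by apply: (@continuous_max _ _ id (fun=> q tm)); [exact: cvg_id | exact: cvg_cst].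
  exact: cvg_cst.
have clamp_preim y : exists t : R, 0 <= t <= b /\ q t = clamp y.
  have c1 : q tm <= clamp y by rewrite /clamp le_min mM le_max lexx orbT.
  have c2 : clamp y <= q tM by rewrite /clamp ge_min lexx orbT.
  have sub x z :
      0 <= x <= b -> 0 <= z <= b -> x <= z ->
      Num.min (q x) (q z) <= clamp y <= Num.max (q x) (q z) ->
      exists t, 0 <= t <= b /\ q t = clamp y.
    move=> /andP[x0 xb] /andP[z0 zb] xz yxz; have [|t] := IVT xz _ yxz.
      by apply: continuous_subspaceW qc; apply: subset_itv; rewrite bnd_simp.
    rewrite in_itv/= => /andP[xt tz] <-; exists t; split => //.
    by rewrite (le_trans x0)// (le_trans tz).
  have [mMle|/ltW Mmle] := leP tm tM.
    by apply: (sub tm tM) => //; rewrite ge_min c1 le_max c2 orbT.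
  by apply: (sub tM tm) => //; rewrite ge_min c1 le_max c2 orbT.
have [tau tauP] := choice clamp_preim.
have YU (e : R) : 0 < e -> exists2 Y : R -> R, continuous Y &
    forall y, `|Y y - U (tau y)| <= e.
  move=> e0; have [Y Yc YP] := Yq e e0; exists (Y \o clamp).
    by move=> y; apply: continuous_comp; [exact: clamp_continuous | exact: Yc].
  by move=> y; have [taub qtau] := tauP y; rewrite /= -qtau; exact: YP.
exists (U \o tau).
  move=> y; apply/cvgrPdist_le => e e0.
  have e30 : 0 < e / 3 by rewrite divr_gt0.
  have [Y Yc YP] := YU _ e30.
  have := Yc y => /cvgrPdist_le/(_ _ e30); apply: filterS => z Yyz.
  have -> : (U \o tau) y - (U \o tau) z =
    - (Y y - U (tau y)) + (Y y - Y z) + (Y z - U (tau z)) by rewrite /=; ring.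
  rewrite (le_trans (ler_normD _ _))// (_ : e = e / 3 + e / 3 + e / 3); last by field.
  rewrite lerD// (le_trans (ler_normD _ _))// lerD// normrN; exact: YP.
(* [tau (q t)] may differ from [t], but [q] agrees there, so both values of [U] are within [e / 2]
   of the same [Y (q t)]. *)
move=> t tb; apply/eqP; rewrite -subr_eq0 -normr_le0; apply/ler_addgt0Pr => e e0.
have [Y _ YP] := Yq _ (divr_gt0 e0 (ltr0Sn _ 1)).
have [taub qtau] := tauP (q t); rewrite clampq// in qtau.
have -> : U t - (U \o tau) (q t) =
  - (Y (q t) - U t) + (Y (q (tau (q t))) - U (tau (q t))) by rewrite /= qtau; ring.
rewrite add0r (le_trans (ler_normD _ _))// (splitr e) normrN lerD//; exact: YP.
Qed.

(** * Integrability of sums and products, and the Picard iteration *)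

Lemma continuous_factor b q (Y h : R -> R) : {within `[0, b], continuous q} ->
  continuous Y -> (forall t, 0 <= t <= b -> h t = Y (q t)) ->
  {within `[0, b], continuous h}.
Proof.
move=> qc Yc hE.
have Yqc : {within `[0, b], continuous (Y \o q)}.
  by move=> x; apply: (@continuous_comp (subspace `[0, b]) _ _ q Y); [exact: qc | exact: Yc].
apply: subspace_eq_continuous Yqc => x.
by rewrite inE/= in_itv/= /from_subspace/= => xb; rewrite hE.
Qed.

Lemma sum_continuous (I : Type) (s : seq I) (P : pred I) (f : I -> R -> R) :
  (forall i, continuous (f i)) -> continuous (fun y => \sum_(i <- s | P i) f i y).
Proof.
move=> fc; elim: s => [|i s IHs].
  by under eq_fun do rewrite big_nil; exact: cst_continuous.
under eq_fun do rewrite big_cons; case: (P i) => // y.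
by apply: cvgD; [exact: fc | exact: IHs].
Qed.

Lemma L1_onM b (h f : R -> R) : {within `[0, b], continuous h} -> L1_on b f ->
  L1_on b (fun t => h t * f t).
Proof.
move=> hc fi.
have mh : measurable_fun `[0, b] h.
  by apply: subspace_continuous_measurable_fun.
have bh : [bounded h x | x in `[0, b]%classic].
  have /compact_bounded[M [Mreal MP]] := continuous_compact hc (@segment_compact _ 0 b).
  by exists M; split=> // z zM x xb; apply: MP => //; exists x.
have := @integrableMl _ _ R mu `[0, b]%classic (measurable_itv _) _ h fi mh bh.
by apply: eq_integrable => // x _ /=; rewrite mulrC.
Qed.

Lemma L1_on_sum b (I : Type) (s : seq I) (P : pred I) (f : I -> R -> R) :
  (forall i, P i -> L1_on b (f i)) -> L1_on b (fun t => \sum_(i <- s | P i) f i t).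
Proof.
move=> fi; elim: s => [|i s IHs].
  apply: (@eq_integrable _ _ _ _ _ _ (EFin \o fun=> 0)) (L1_on_cst b 0) => // x _.
  by rewrite /= big_nil.
have [Pi|Pi] := boolP (P i).
  apply: eq_integrable (L1_onD (fi i Pi) IHs) => // x _.
  by rewrite /= big_cons Pi.
apply: eq_integrable IHs => // x _.
by rewrite /= big_cons (negbTE Pi).
Qed.

Lemma L1_on_norm b f : L1_on b f -> L1_on b (fun t => `|f t|).
Proof. exact: integrable_norm. Qed.

Lemma ae_eq_sumM b (I : finType) (P : pred I) (h w w' : I -> R -> R) :
  (forall i, ae_eq mu `[0, b]%classic (w i) (w' i)) ->
  ae_eq mu `[0, b]%classic (fun t => \sum_(i | P i) h i t * w i t)
    (fun t => \sum_(i | P i) h i t * w' i t).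
Proof.
move=> ww'.
have ae_filter : Filter (almost_everywhere mu) by exact: ae_filter_ringOfSetsType.
have := @filter_forall _ _ (fun i x => `[0, b]%classic x -> w i x = w' i x)
  (almost_everywhere mu) ae_filter ww'.
apply: filterS => t {}ww' tb.
by apply: eq_bigr => i _; rewrite ww'.
Qed.

Lemma Rintegral_itv0cc_split b (f : R -> R) s t : L1_on b f -> 0 <= s -> s <= t -> t <= b ->
  \int[mu]_(x in `[0, t]) f x =
  \int[mu]_(x in `[0, s]) f x + \int[mu]_(x in `]s, t]) f x.
Proof.
move=> fi s0 st tb; rewrite -(@Rintegral_itvB _ f (BLeft 0) (BRight t) s).
- by rewrite addrC subrK.
- exact: L1_onS fi.
- by rewrite bnd_simp.
- by rewrite bnd_simp.
Qed.

Lemma L1_on_primitive_continuous b (f : R -> R) : 0 <= b -> L1_on b f ->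
  {within `[0, b], continuous (fun t => \int[mu]_(x in `[0, t]) f x)}.
Proof. exact: parameterized_integral_continuous. Qed.

(* Picard iteration: every iterate is a function of [q], and they converge uniformly
   to [U]; the contraction is local in [t] because the primitive of the Lipschitz
   weight is continuous. *)
Lemma picard_factor b (I : finType) (phi : I -> R -> R) (L : I -> R)
    (w g : I -> R -> R) q dq (U : R -> R) : 0 <= b ->
  has_derivative_on b q dq ->
  (forall i, continuous (g i)) -> (forall i, L1_on b (w i)) ->
  (forall i, ae_eq mu `[0, b]%classic (w i) (fun t => g i (q t) * dq t)) ->
  (forall i, continuous (phi i)) ->
  (forall i x y, `|phi i x - phi i y| <= L i * `|x - y|) ->
  {within `[0, b], continuous U} ->
  (forall t, 0 <= t <= b ->
     U t = \int[mu]_(s in `[0, t]) (\sum_i phi i (U s) * w i s)) ->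
  exists2 X : R -> R, continuous X & forall t, 0 <= t <= b -> U t = X (q t).
Proof.
move=> b0 qd gc wi wE phic phiL Uc UE.
have qc := has_derivative_on_continuous qd.
pose f (h : R -> R) (t : R) := \sum_i phi i (h t) * w i t.
pose Un n := iter n (fun h t => \int[mu]_(s in `[0, t]) f h s) (fun=> 0).
have fi h : {within `[0, b], continuous h} -> L1_on b (f h).
  move=> hc; apply: L1_on_sum => i _; apply: L1_onM => //.
  exact: (continuous_factor hc (phic i)).
have Unq n : exists2 Y : R -> R, continuous Y & forall t, 0 <= t <= b -> Un n t = Y (q t).
  elim: n => [|n [Y Yc YE]]; first by exists (fun=> 0) => // x; exact: cvg_cst.
  have Unc : {within `[0, b], continuous (Un n)}.
    exact: continuous_factor YE.
  (* If [Un n = Y (q)], the next integrand has again the form of a continuous function of [q] times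
     [dq]. *)
  apply: (primitive_comp b0 qd (w := f (Un n))
    (g := fun y => \sum_i phi i (Y y) * g i y)).
  - apply: sum_continuous => i y; apply: cvgM; last exact: gc.
    by apply: continuous_comp; [exact: Yc | exact: phic].
  - exact: fi Unc.
  - have := ae_eq_sumM predT (fun i t => phi i (Un n t)) wE.
    apply: filterS => t ft tb; rewrite /f (ft tb) mulr_suml.
    apply: eq_bigr => i _; rewrite YE ?mulrA//.
have Unc n : {within `[0, b], continuous (Un n)}.
  have [Y Yc YE] := Unq n.
  exact: continuous_factor YE.
have [M UM] : exists M : R, forall t, 0 <= t <= b -> `|U t| <= M.
  have [tM _ MP] : exists2 c, c \in `[0, b] & forall t, t \in `[0, b] -> `|U t| <= `|U c|.
    apply: EVT_max => //; apply: (continuous_factor Uc (Y := fun y => `|y|)) => //.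
    exact: norm_continuous.
  by exists `|U tM| => t tb; apply: MP; rewrite in_itv.
pose W t := \int[mu]_(s in `[0, t]) (\sum_i L i * `|w i s|).
have Wi : L1_on b (fun s => \sum_i L i * `|w i s|).
  apply: L1_on_sum => i _; apply: L1_onM; last exact: L1_on_norm.
  by move=> x; exact: cvg_cst.
have /within_itv0ccP Wc : {within `[0, b], continuous W} by exact: L1_on_primitive_continuous.
(* The rate [3 / 4] is the same on every initial interval; only the constant [A] grows as the
   interval is extended. *)
have [A AP] : exists A : R, forall n t, 0 <= t <= b -> `|Un n t - U t| <= A * (3 / 4) ^+ n.
  apply: (@interval_induction _ b (fun T => exists A : R, forall n t, 0 <= t <= T ->
      `|Un n t - U t| <= A * (3 / 4) ^+ n)) => //.
    exists 0 => n t t0; have -> : t = 0 by apply/eqP; rewrite eq_le andbC.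
    have -> : Un n 0 = 0.
      by case: n => // n; rewrite /= set_itv1 Rintegral_set1.
    by rewrite UE ?lexx// set_itv1 Rintegral_set1 subrr normr0 mul0r.
  (* [W] varies by at most [1 / 4] on either side of [x], so the contraction factor across the step
     is [1 / 2]. *)
  move=> x xb; have [d d0 dP] := Wc x xb _ (divr_gt0 (@ltr01 R) (ltr0Sn _ 3)).
  exists d => // s t /andP[s0 sx] /andP[xt tb] xsd txd [A AP].
  have A0 : 0 <= A.
    have := AP 0 s; rewrite s0 lexx expr0 mulr1 => /(_ isT); exact: le_trans.
  have st := le_trans sx xt.
  have Wst y : s <= y <= t -> W y - W s <= 1 / 2.
    move=> /andP[sy yt]; have Wy : `|W y - W x| <= 1 / 4.
      by apply: dP; [rewrite (le_trans s0)//= (le_trans yt) | rewrite ltr_norml; lra].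
    have Ws : `|W s - W x| <= 1 / 4.
      by apply: dP; [rewrite s0 (le_trans sx)//= (le_trans xt) | rewrite ltr_norml; lra].
    by move: Wy Ws; rewrite !ler_norml => /andP[_ ?] /andP[? _]; lra.
  (* [M] covers the error of the zeroth iterate. From [A <= B / 3], the error carried over from [s]
     is at most [B / 4 * (3 / 4) ^+ n]; adding the contracted [B / 2 * (3 / 4) ^+ n] gives exactly
     [B * (3 / 4) ^+ n.+1]. *)
  exists (Num.max (3 * A) M) => n.
  set B := Num.max _ _.
  have BA : 3 * A <= B by rewrite le_max lexx.
  have B0 : 0 <= B by apply: le_trans BA; rewrite mulr_ge0.
  elim: n => [y /andP[y0 yt]|n IHn y /andP[y0 yt]].
    by rewrite expr0 mulr1 sub0r normrN le_max UM ?orbT// y0 (le_trans yt).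
  have [ys|/ltW sy] := leP y s.
    rewrite (le_trans (AP _ _ _)) ?y0// ler_wpM2r ?exprn_ge0 ?divr_ge0//.
    by apply: le_trans BA; rewrite ler_peMl// ler1n.
  have yb := le_trans yt tb.
  have iS h : L1_on b h -> mu.-integrable `]s, y] (EFin \o h).
    by apply: integrableS => //; apply: subset_itv; rewrite bnd_simp.
  have -> : Un n.+1 y - U y = (Un n.+1 s - U s) +
      \int[mu]_(x in `]s, y]) (f (Un n) x - f U x).
    have -> : \int[mu]_(x in `]s, y]) (f (Un n) x - f U x) =
        \int[mu]_(x in `]s, y]) f (Un n) x - \int[mu]_(x in `]s, y]) f U x.
      by apply: RintegralB => //; apply: iS; exact: fi.
    have -> : Un n.+1 y = Un n.+1 s + \int[mu]_(x in `]s, y]) f (Un n) x.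
      exact: (Rintegral_itv0cc_split (fi _ (Unc n)) s0 sy yb).
    have -> : U y = U s + \int[mu]_(x in `]s, y]) f U x.
      rewrite (UE y) ?y0// (UE s) ?s0 ?(le_trans sy)//.
      exact: (Rintegral_itv0cc_split (fi _ Uc) s0 sy yb).
    by ring.
  apply: (le_trans (ler_normD _ _)).
  have h1 := AP n.+1 s; rewrite s0 lexx in h1; have {}h1 := h1 isT.
  have h2 : `|\int[mu]_(x in `]s, y]) (f (Un n) x - f U x)| <=
      (W y - W s) * (B * (3 / 4) ^+ n).
    have -> : W y - W s = \int[mu]_(x in `]s, y]) (\sum_i L i * `|w i x|).
      by rewrite /W (Rintegral_itv0cc_split Wi s0 sy yb) addrC addKr.
    have iD : mu.-integrable `]s, y] (EFin \o (fun x => f (Un n) x - f U x)).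
      apply: (iS (fun x => f (Un n) x - f U x)).
      by apply: L1_onD; [exact: fi | apply: L1_onN; exact: fi].
    rewrite (le_trans (le_normr_Rintegral _ iD))//.
    rewrite -(RintegralZr _ _ (iS _ Wi))//; apply: le_Rintegral => //.
    - exact: integrable_norm.
    - apply: (iS (fun x => (\sum_i L i * `|w i x|) * (B * (3 / 4) ^+ n))).
      apply: eq_integrable (L1_onM (h := fun=> B * (3 / 4) ^+ n) _ Wi) => //.
        by move=> z _; rewrite /= mulrC.
      by move=> z; exact: cvg_cst.
    move=> z; rewrite /= in_itv/= => /andP[sz zy].
    rewrite /f -sumrB mulr_suml (le_trans (ler_norm_sum _ _ _))//.
    apply: ler_sum => i _; rewrite -mulrBl normrM mulrAC ler_wpM2r//.
    rewrite (le_trans (phiL _ _ _))// ler_wpM2l//; last first.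
      by rewrite IHn// (le_trans s0 (ltW sz)) (le_trans zy).
    (* The Lipschitz bound between [1] and [0] forces [L i] to be nonnegative. *)
    by have := phiL i 1 0; rewrite subr0 normr1 mulr1; exact: le_trans.
  have pn : 0 <= (3 / 4 : R) ^+ n by rewrite exprn_ge0// divr_ge0.
  have h3 : (W y - W s) * (B * (3 / 4) ^+ n) <= 1 / 2 * (B * (3 / 4) ^+ n).
    by rewrite ler_wpM2r ?mulr_ge0// Wst// sy.
  apply: (le_trans (lerD h1 (le_trans h2 h3))).
  rewrite exprS; nra.
apply: factor_uniform_limit => // e e0.
have [n An] : exists n, A * (3 / 4) ^+ n <= e.
  have /cvgrPdist_le/(_ e e0) : (fun n => A * (3 / 4) ^+ n) @ \oo --> (0 : R).
    rewrite -(mulr0 A); apply: cvgM; first exact: cvg_cst.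
    by apply: cvg_expr; rewrite ger0_norm ?divr_ge0// ltr_pdivrMr// mul1r ltr_nat.
  move=> /filter_ex[n]; rewrite sub0r normrN => nP; exists n.
  exact: le_trans (ler_norm _) nP.
have [Y Yc YE] := Unq n; exists Y => // t tb.
by rewrite -YE// (le_trans (AP n t tb)).
Qed.

(** * From the composition condition to the moment conditions *)

Lemma composition_moment (m : nat) (m_ge2 : (2 <= m)%N) (omega : R) (omega_ge0 : 0 <= omega)
    (u : 'I_m -> R -> R) :
  (forall i, L1_on omega (u i)) ->
  composition_condition omega u -> moment_conditions omega m_ge2 u.
Proof.
move=> u_L1 [q [dq [ub [qd q_loop ubc uE]]]] i k _.
pose i1 : 'I_m := Ordinal (ltnW m_ge2).
have [X Xc XE] := primitive_comp omega_ge0 qd (ubc i1) (u_L1 i1) (uE i1).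
have {}XE (t : R) : 0 <= t <= omega -> Ex1 m_ge2 u t = X (q t) by exact: XE.
have Xkc : continuous (fun y => X y ^+ k).
  by move=> y; apply: (@continuous_comp _ _ _ X (fun z => z ^+ k));
    [exact: Xc | exact: exprn_continuous].
pose w t := u i t * Ex1 m_ge2 u t ^+ k.
have wi : L1_on omega w.
  have Ec : {within `[0, omega], continuous (fun t => Ex1 m_ge2 u t ^+ k)}.
    apply: (continuous_factor (has_derivative_on_continuous qd) Xkc) => t tw.
    by rewrite XE.
  by apply: eq_integrable (L1_onM Ec (u_L1 i)) => // x _; rewrite /= mulrC.
have [||Y Yc YE] := primitive_comp omega_ge0 qd (g := fun y => ub i y * X y ^+ k) _ wi.
- by move=> y; apply: cvgM; [exact: ubc | exact: Xkc].
- apply: filterS (uE i) => t ut tw; rewrite /w ut// XE; last by move: tw; rewrite /= in_itv.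
  by rewrite mulrAC.
(* Since [q] closes up, [Y (q omega)] is [Y (q 0)], the integral over a single point. *)
rewrite -/(w _) YE ?lexx ?omega_ge0// q_loop -YE ?lexx//.
by rewrite set_itv1 Rintegral_set1.
Qed.

(** * Bounded Lipschitz coefficients *)

(** The bound on the values makes the class stable under products, hence under powers of [rho]. *)
Definition bounded_lipschitz (phi : R -> R) : Prop :=
  exists K : R, (forall x, `|phi x| <= K) /\ (forall x y, `|phi x - phi y| <= K * `|x - y|).

Lemma bounded_lipschitzM (phi psi : R -> R) :
  bounded_lipschitz phi -> bounded_lipschitz psi ->
  bounded_lipschitz (fun x => phi x * psi x).
Proof.
move=> [K [phiK phiL]] [M [psiM psiL]].
have K0 : 0 <= K by apply: le_trans (phiK 0).
have M0 : 0 <= M by apply: le_trans (psiM 0).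
(* One constant has to serve as the bound [K * M] and as the Lipschitz constant [2 * K * M]. *)
exists (2 * K * M + K * M); split => [x|x y].
  rewrite normrM (le_trans (ler_pM _ _ (phiK x) (psiM x)))// lerDr.
  by rewrite !mulr_ge0.
have -> : phi x * psi x - phi y * psi y =
  phi x * (psi x - psi y) + (phi x - phi y) * psi y by ring.
rewrite (le_trans (ler_normD _ _))// !normrM.
have h1 := ler_pM (normr_ge0 _) (normr_ge0 _) (phiK x) (psiL x y).
have h2 := ler_pM (normr_ge0 _) (normr_ge0 _) (phiL x y) (psiM y).
apply: (le_trans (lerD h1 h2)); rewrite le_eqVlt; apply/orP.
have := normr_ge0 (x - y); set d := `|_|; move=> d0.
have : 0 <= K * M * d by rewrite !mulr_ge0.
by rewrite le_eqVlt => /orP[/eqP H|H]; [left; apply/eqP | right]; lra.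
Qed.

Lemma bounded_lipschitzX (phi : R -> R) n :
  bounded_lipschitz phi -> bounded_lipschitz (fun x => phi x ^+ n).
Proof.
move=> phiK; elim: n => [|n IHn].
  exists 1; split => [x|x y]; first by rewrite expr0 normr1.
  by rewrite !expr0 subrr normr0 mul1r.
have := bounded_lipschitzM phiK IHn.
by under eq_fun do rewrite -exprS.
Qed.

(* The truncation makes [r / (1 - r x)] globally Lipschitz; it is inactive when
   [c <= 1 - r x]. *)
Definition rho (r c x : R) : R := r / Num.max c (1 - r * x).

Lemma rho_bounded_lipschitz (r c : R) : 0 < r -> 0 < c -> bounded_lipschitz (rho r c).
Proof.
move=> r0 c0; pose M x := Num.max c (1 - r * x).
have cM x : c <= M x by rewrite le_max lexx.
have M0 x : 0 < M x by exact: lt_le_trans (cM x).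
have invM z : (M z)^-1 <= c^-1 by rewrite lef_pV2 ?cM ?posrE ?M0.
(* [r / c] bounds the values and its square is a Lipschitz constant. *)
exists (r / c + r / c * (r / c)); split => [x|x y].
  rewrite ger0_norm ?divr_ge0 ?(ltW r0) ?(ltW (M0 x))//.
  apply: (@le_trans _ _ (r / c)).
    by rewrite ler_pM2l//; exact: invM.
  by rewrite lerDl !mulr_ge0 ?invr_ge0 ?(ltW r0) ?(ltW c0).
have -> : rho r c x - rho r c y = r / M x * ((M y - M x) / M y).
  by rewrite /rho -/(M x) -/(M y); field; rewrite !gt_eqF.
have MM : `|M y - M x| <= r * `|x - y|.
  have -> : r * `|x - y| = `|(1 - r * y) - (1 - r * x)|.
    rewrite -{1}(gtr0_norm r0) -normrM; congr (`|_|); ring.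
  rewrite /M; case: (leP c (1 - r * y)) => ?; case: (leP c (1 - r * x)) => ? //.
  - by rewrite !ger0_norm; lra.
  - by rewrite distrC [leRHS]distrC !ger0_norm; lra.
  - by rewrite subrr normr0.
have d0 := normr_ge0 (x - y).
have rc0 : 0 <= r / c by rewrite divr_ge0 ?ltW.
rewrite !normrM !normfV (gtr0_norm r0) (gtr0_norm (M0 x)) (gtr0_norm (M0 y)).
apply: (@le_trans _ _ (r / c * (r * `|x - y| / c))).
  apply: ler_pM.
  - by rewrite divr_ge0 ?ltW.
  - by rewrite divr_ge0// ltW.
  - by rewrite ler_pM2l.
  - by apply: ler_pM => //; rewrite invr_ge0 ltW.
have -> : r / c * (r * `|x - y| / c) = r / c * (r / c) * `|x - y| by ring.
by rewrite ler_wpM2r// lerDr.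
Qed.

Lemma bounded_lipschitz_continuous (phi : R -> R) : bounded_lipschitz phi -> continuous phi.
Proof.
move=> [K [phiK phiL]] x; apply/cvgrPdist_le => e e0.
have K1 : 0 < K + 1 by rewrite ltr_wpDl// (le_trans _ (phiK 0)).
apply/nbhs_ballP; exists (e / (K + 1)) => /=; first by rewrite divr_gt0.
move=> y; rewrite /ball/= ltr_pdivlMr// mulrC => /ltW H.
by apply: le_trans H; rewrite (le_trans (phiL _ _))// ler_wpM2r// lerDl.
Qed.

(** * The composition condition for [u], by inverting the relation to [v] *)

Lemma composition_of_transform (m : nat) (m_ge2 : (2 <= m)%N)
    (omega r : R) (omega_gt0 : 0 < omega) (r_gt0 : 0 < r)
    (v : 'I_m -> R -> R)
    (v_L1 : forall i : 'I_m, L1_on omega (v i))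
    (v_comp : composition_condition omega v)
    (u : 'I_m -> R -> R)
    (u_L1 : forall i : 'I_m, L1_on omega (u i))
    (uv_lt : forall (i : 'I_m) (lt_i1_m : (i.+1 < m)%N),
       ae_eq (@lebesgue_measure R) `[0, omega]%classic (v i)
         (fun t : R => u i t - r * u (Ordinal lt_i1_m) t / (1 - r * Ex1 m_ge2 u t)))
    (uv_last : forall i : 'I_m, i.+1 = m ->
       ae_eq (@lebesgue_measure R) `[0, omega]%classic (v i) (u i))
    (Ex1_lt : forall t : R, t \in `[0, omega] -> Ex1 m_ge2 u t < 1 / r) :
  composition_condition omega u.
Proof.
have [q [dq [vb [qd q_loop vbc vE]]]] := v_comp.
pose i1 : 'I_m := Ordinal (ltnW m_ge2).
have w0 := ltW omega_gt0.
pose U t := Ex1 m_ge2 u t.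
have Uc : {within `[0, omega], continuous U}.
  exact: (L1_on_primitive_continuous w0 (u_L1 i1)).
(* Compactness turns the pointwise bound on [Ex1] into a positive minimum [c] of [1 - r * U], so the
   truncation in [rho] is inactive along [U]. *)
have [tM tMw UM] := EVT_max w0 Uc.
pose c := 1 - r * U tM.
have c0 : 0 < c.
  by have := Ex1_lt _ tMw; rewrite ltr_pdivlMr// mulrC -subr_gt0.
have rhoE t : 0 <= t <= omega -> rho r c (U t) = r / (1 - r * U t).
  move=> tw; rewrite /rho max_r// lerD2l lerN2 ler_pM2l//.
  by apply: UM; rewrite in_itv.
(* The triangular matrix expressing [u] through [v]. The test is needed because truncated
   subtraction would give [1] below the diagonal. *)
pose phi (i j : 'I_m) (x : R) := if (i <= j)%N then rho r c x ^+ (j - i) else 0.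
have phiBL i j : bounded_lipschitz (phi i j).
  rewrite /phi; case: (i <= j)%N; first exact/bounded_lipschitzX/rho_bounded_lipschitz.
  by exists 0; split => [x|x y]; rewrite ?subrr normr0 ?mul0r.
have uE (i : 'I_m) :
    ae_eq mu `[0, omega]%classic (u i) (fun t => \sum_j phi i j (U t) * v j t).
  (* Induction downwards from the last index, where [u] and [v] agree. *)
  have [n] := ubnP (m - i); elim: n i => // n IHn i; rewrite ltnS => mi.
  have sum_i t : \sum_j phi i j (U t) * v j t =
      v i t + \sum_(j | j != i) phi i j (U t) * v j t.
    by rewrite (bigD1 i)//= /phi leqnn subnn expr0 mul1r.
  have [i1m|mi1] := ltnP i.+1 m.
    have {}IHn := IHn (Ordinal i1m) _.
    have /IHn uE1 : (m - Ordinal i1m < n)%N by rewrite /= subnS prednK// subn_gt0.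
    apply: filterS2 uE1 (uv_lt i i1m) => t uE1 uv tw.
    rewrite sum_i.
    have tw' : 0 <= t <= omega by move: tw; rewrite /= in_itv.
    (* For [j > i] a further factor [rho] turns the exponent [j - i.+1] into [j - i], and row [i.+1]
       has no term at [j = i]. *)
    have -> : \sum_(j | j != i) phi i j (U t) * v j t = rho r c (U t) * u (Ordinal i1m) t.
      rewrite uE1// mulr_sumr [RHS](bigD1 i)//= {2}/phi /= ltnn mul0r mulr0 add0r.
      apply: eq_bigr => j ji; rewrite mulrA; congr (_ * _); rewrite /phi /=.
      have [ij|ji'|/val_inj ij] := ltngtP i j; last by rewrite ij eqxx in ji.
        by rewrite -exprS -subSn.
      by rewrite mulr0.
    by rewrite rhoE// uv// mulrAC subrK.
  have im : i.+1 = m by apply/eqP; rewrite eqn_leq mi1 ltn_ord.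
  apply: filterS (uv_last i im) => t uv tw; rewrite sum_i -uv// big1 ?addr0// => j ji.
  rewrite /phi; case: ifP => [ij|_]; last by rewrite mul0r.
  case/eqP: ji; apply/val_inj/eqP; rewrite /= eqn_leq ij andbT -ltnS im.
  exact: ltn_ord.
have [L LP] : exists L : 'I_m -> R, forall j x y,
    `|phi i1 j x - phi i1 j y| <= L j * `|x - y|.
  have H j : exists L : R, forall x y, `|phi i1 j x - phi i1 j y| <= L * `|x - y|.
    by have [L [_ LP]] := phiBL i1 j; exists L.
  by have [L LP] := choice H; exists L.
have phic i j : continuous (phi i j) by exact: bounded_lipschitz_continuous.
have phiUi i : L1_on omega (fun t => \sum_j phi i j (U t) * v j t).
  apply: L1_on_sum => j _; apply: L1_onM => //.
  exact: (continuous_factor Uc (phic i j)).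
have [X Xc XE] : exists2 X : R -> R, continuous X &
    forall t, 0 <= t <= omega -> U t = X (q t).
  apply: (picard_factor w0 qd vbc v_L1 vE (phic i1) LP Uc) => t /andP[t0 tw].
  (* Integrating the expansion of the first component gives the integral equation for [U]. *)
  have : ae_eq mu `[0, t]%classic (u i1) (fun t => \sum_j phi i1 j (U t) * v j t).
    by apply: ae_eq_subset (uE i1); apply: subset_itvl; rewrite bnd_simp.
  move=> uEt; rewrite /U /Ex1 /Rintegral; congr fine.
  apply: ae_eq_integral => //.
  - exact: (measurable_int mu (L1_onS tw (u_L1 i1))).
  - exact: (measurable_int mu (L1_onS tw (phiUi i1))).
  by apply: filterS uEt => s us st /=; rewrite us.
exists q, dq, (fun i y => \sum_j phi i j (X y) * vb j y); split => // i.
  apply: sum_continuous => j y; apply: cvgM; last exact: vbc.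
  by apply: continuous_comp; [exact: Xc | exact: phic].
apply: ae_eq_trans (uE i) _.
have := ae_eq_sumM predT (fun j t => phi i j (U t)) vE.
apply: filterS => t ft tw; rewrite (ft tw) mulr_suml.
by apply: eq_bigr => j _; rewrite XE ?mulrA.
Qed.

End lebesgue.

Theorem theorem9 (R : realType) (m : nat) (m_ge2 : (2 <= m)%N)
    (omega r : R) (omega_gt0 : 0 < omega) (r_gt0 : 0 < r)
    (v : 'I_m -> R -> R)
    (v_L1 : forall i : 'I_m, L1_on omega (v i))
    (v_comp : composition_condition omega v)
    (u : 'I_m -> R -> R)
    (u_L1 : forall i : 'I_m, L1_on omega (u i))
    (uv_lt : forall (i : 'I_m) (lt_i1_m : (i.+1 < m)%N),
       ae_eq (@lebesgue_measure R) `[0, omega]%classic (v i)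
         (fun t : R => u i t - r * u (Ordinal lt_i1_m) t / (1 - r * Ex1 m_ge2 u t)))
    (uv_last : forall i : 'I_m, i.+1 = m ->
       ae_eq (@lebesgue_measure R) `[0, omega]%classic (v i) (u i))
    (Ex1_lt : forall t : R, t \in `[0, omega] -> Ex1 m_ge2 u t < 1 / r) :
  composition_condition omega u <-> moment_conditions omega m_ge2 u.
Proof.
split=> [|_]; first exact: (composition_moment m_ge2 (ltW omega_gt0) u_L1).
exact: (composition_of_transform omega_gt0 r_gt0 v_L1 v_comp u_L1 uv_lt uv_last Ex1_lt).
Qed.
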